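(* Let $f:\mathbb{S}^4\to\mathbb{C}$ be a $(\lambda,\mu)$-eigenfunction on the unit round sphere $\mathbb{S}^4\subset\mathbb{R}^5$ given by a polynomial $F:\mathbb{R}^5\to\mathbb{C}$ with $\deg F\leq 3$, such that $0\in f(\mathbb{S}^4)$ is a regular value of $f$. Then $f^{-1}(0)$ is a flat section of $\mathbb{S}^4$.
   Context: Let $(M,g)$ be a Riemannian manifold, and extend $g$ to a complex bilinear form on the complexified tangent bundle $T^{\mathbb{C}}M$. For smooth functions $\varphi,\psi: M\to\mathbb{C}$ define $\tau(\varphi) := \operatorname{div}\operatorname{grad}\varphi$ and $\varkappa(\varphi,\psi) := g(\operatorname{grad}\varphi,\operatorname{grad}\psi)$ (complex bilinear, not Hermitian). A function $f: M\to\mathbb{C}$ is a $(\lambda,\mu)$-eigenfunction if there exist $\lambda,\mu\in\mathbb{C}$ such that $\tau(f)=\lambda f$ and $\varkappa(f,f)=\mu f^2$. A $(\lambda,\mu)$-eigenfunction $f$ on $\mathbb{S}^4$ (with the canonical round metric) is said to be given by a polynomial $F$ if $F:\mathbb{R}^5\to\mathbb{C}$ is a homogeneous polynomial with complex coefficients that is a $(0,0)$-eigenfunction on Euclidean $\mathbb{R}^5$ (i.e. $\tau(F)=0$ and $\varkappa(F,F)=0$) and $f=F|_{\mathbb{S}^4}$. Regularity of the value $0$ is meant for $f$ as a smooth map $\mathbb{S}^4\to\mathbb{C}\cong\mathbb{R}^2$. A flat section of $\mathbb{S}^4$ is the intersection of $\mathbb{S}^4$ with a linear subspace (plane through the origin)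 of $\mathbb{R}^5$. *)

(* Defs.v *)
From HB Require Import structures.
From mathcomp Require Import all_boot all_order all_algebra.
From mathcomp Require Import all_classical all_reals all_analysis.
From mathcomp Require Import complex.
(* Not imported in full: the notations of mpoly clash with those of all_analysis. *)
From mathcomp Require mpoly.
Import (canonicals, coercions) mpoly.
Set Implicit Arguments.
Unset Strict Implicit.
Unset Printing Implicit Defensive.
Import Order.TTheory GRing.Theory Num.Theory numFieldNormedType.Exports.
Local Open Scope classical_set_scope.
Local Open Scope ring_scope.
Local Open Scope complex_scope.

Section ComplexValued.
Context {R : realType} {n : nat}.
Implicit Types (g : 'rV[R]_n -> R[i]) (v x : 'rV[R]_n).

(* R[i] is not a normed module over R in the libraries, so real derivatives of
   complex-valued functions are taken on the real and imaginary parts. *)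
Definition cderive g v x : R[i] :=
  ('D_v (fun y => complex.Re (g y)) x) +i* ('D_v (fun y => complex.Im (g y)) x).

Definition cdifferentiable g x : Prop :=
  differentiable (fun y => complex.Re (g y)) x /\
  differentiable (fun y => complex.Im (g y)) x.

Definition iter_cderive (vs : seq 'rV[R]_n) g : 'rV[R]_n -> R[i] :=
  foldr (fun v h => cderive h v) g vs.

End ComplexValued.

(* A submanifold M of R^n with the induced metric. For x in M, [tproj x] is the
   matrix of the orthogonal projection of R^n onto T_x M, and [retr] is a smooth
   retraction of a neighbourhood of M onto M. A function or vector field on M is
   represented by a total function on R^n of which only the values on M are
   used: it is always extended off M by precomposition with [retr] before being
   differentiated. *)
Record submanifold (R : realType) (n : nat) := Submanifold {
  carrier : set 'rV[R]_n;
  tproj : 'rV[R]_n -> 'M[R]_n;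
  retr : 'rV[R]_n -> 'rV[R]_n }.

Definition euclidean (R : realType) (n : nat) : submanifold R n :=
  Submanifold setT (fun _ => 1%:M) id.

(* The library norm `|x| on row vectors is the sup norm. *)
Definition enorm {R : realType} {n : nat} (x : 'rV[R]_n) : R :=
  Num.sqrt (\sum_(i < n) x 0 i ^+ 2).

(* The unit sphere of R^n (of dimension n - 1): T_x is the orthogonal complement
   of x. *)
Definition sphere (R : realType) (n : nat) : submanifold R n :=
  Submanifold [set x | enorm x = 1]
              (fun x => 1%:M - x^T *m x)
              (fun x => (enorm x)^-1 *: x).

Section RiemannianOperators.
Context {R : realType} {n : nat} (M : submanifold R n).
Implicit Types (phi psi : 'rV[R]_n -> R[i]) (X : 'rV[R]_n -> 'rV[R[i]]_n).
Implicit Types (v x : 'rV[R]_n).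

Definition smooth phi : Prop :=
  forall x, carrier M x -> forall vs : seq 'rV[R]_n,
  \forall y \near x, cdifferentiable (iter_cderive vs (phi \o retr M)) y.

(* d(phi)_x(v), for v in T_x M *)
Definition tderive phi v x : R[i] := cderive (phi \o retr M) v x.

Definition ctproj x : 'M[R[i]]_n := map_mx (real_complex R) (tproj M x).

(* The gradient for the induced metric is the tangential part of the Euclidean
   gradient of any extension. *)
Definition grad phi x : 'rV[R[i]]_n :=
  (\row_j tderive phi (delta_mx 0 j) x) *m ctproj x.

(* The Levi-Civita connection of the induced metric is the tangential part of
   the Euclidean derivative. *)
Definition nabla v X x : 'rV[R[i]]_n :=
  (\row_j tderive (fun y => X y 0 j) v x) *m ctproj x.

(* The trace of v |-> nabla_v X on T_x M; row i of [tproj M x] is the tangential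
   part of the i-th vector of the standard basis of R^n. *)
Definition divergence X x : R[i] :=
  \sum_(i < n) nabla (row i (tproj M x)) X x 0 i.

Definition tau phi x : R[i] := divergence (grad phi) x.

Definition kappa phi psi x : R[i] :=
  \sum_(i < n) grad phi x 0 i * grad psi x 0 i.

Definition eigenfunction (lambda mu : R[i]) phi : Prop :=
  [/\ smooth phi,
      forall x, carrier M x -> tau phi x = lambda * phi x &
      forall x, carrier M x -> kappa phi phi x = mu * phi x ^+ 2].

Definition regular_value phi (c : R[i]) : Prop :=
  forall x, carrier M x -> phi x = c ->
  forall w : R[i], exists v, v *m tproj M x = v /\ tderive phi v x = w.

End RiemannianOperators.

Definition polyfun {R : realType} {n : nat} (F : mpoly.mpoly n R[i])
    (x : 'rV[R]_n) : R[i] :=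
  mpoly.meval (fun i => (x 0 i)%:C) F.

(* msize is the degree plus one, and 0 for the zero polynomial. *)
Definition degree {R : realType} {n : nat} (F : mpoly.mpoly n R[i]) : nat :=
  (mpoly.msize F).-1.

Definition homogeneous {R : realType} {n : nat} (F : mpoly.mpoly n R[i]) : Prop :=
  exists d : nat, F \is @mpoly.ishomog1 n R[i] d mpoly.mdeg.

Definition given_by_polynomial {R : realType} {n : nat}
    (f : 'rV[R]_n -> R[i]) (F : mpoly.mpoly n R[i]) : Prop :=
  [/\ homogeneous F,
      eigenfunction (euclidean R n) 0 0 (polyfun F) &
      forall x, carrier (sphere R n) x -> f x = polyfun F x].

Definition flat_section {R : realType} {n : nat} (A : set 'rV[R]_n) : Prop :=
  exists W : {vspace 'rV[R]_n}, A = carrier (sphere R n) `&` [set x | x \in W].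

(* Main.v *)
Require Import Defs.
From mathcomp Require Import all_boot all_order all_algebra.
From mathcomp Require Import all_classical all_reals all_analysis.
From mathcomp Require Import complex.
From mathcomp Require Import ring.
From mathcomp Require mpoly.
Import (canonicals, coercions) mpoly.
Set Implicit Arguments.
Unset Strict Implicit.
Unset Printing Implicit Defensive.
Import Order.TTheory GRing.Theory Num.Theory numFieldNormedType.Exports.
Local Open Scope classical_set_scope.
Local Open Scope ring_scope.

(** Let d be the degree of F. In degree 1 the zero set is visibly the trace of a
    linear subspace, and the other degrees cannot occur. What rules out a degree
    is a real vector x <> 0 with grad F (x) = 0 and F(x) = 0. In degree 0, F is
    constant and any zero of f will do. In degrees 2 and 3 a real zero x <> 0 of the
    gradient is enough: Euler's identity gives F(x) = 0, and after
    rescaling x lies on the sphere; near x the function f is F(y/|y|), that is,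
    |y|^-d F(y), whose differential at x vanishes, so that 0 is not a regular
    value ([regular_no_critical]).

    The gradient of F is isotropic at all real points, hence at all complex
    points, because a polynomial that vanishes on R^5 vanishes on C^5
    ([meval_real_eq0], [pgrad_null]). It is enough to find a subspace V of C^5,
    isotropic for the bilinear form, such that grad F vanishes at every real x
    orthogonal to V. Indeed an isotropic subspace of C^5 has dimension at most
    2, so being orthogonal to it amounts to at most 4 real linear equations on
    R^5 ([real_orth_isotropic]).

    If d = 2, grad F (x) = x H with H symmetric, and H H = 0: the row space of
    H is such a V.

    If d = 3, let x y be the commutative product on C^5 given by
    <x y, z> = D^3 F (x, y, z). The bilinear form is associative for it,
    <x y, z> = <x, y z>, and x x = 2 grad F (x), so that <x x, x x> = 0 for
    all x. Polarizing gives x (x x) = 0, then x (y y) = - 2 y (y x), then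
    y (y (y x)) = 0. Suppose that q = y (y z) <> 0 for some y and z. Nilpotency
    of the multiplications makes z, y z, q, y, y y linearly independent, hence
    a basis in dimension 5; expanding z z in this basis shows that
    <z z, y y> = 0 and then that q is orthogonal to the whole basis, which is
    absurd ([chain_absurd]). So y (y z) = 0 identically, which by the identity
    above and polarization means that x (y z) = 0. Then
    <x y, z w> = <x, y (z w)> = 0: the span V of all products is isotropic. If
    x is orthogonal to V, then <x x, z> = <x, x z> = 0 for all z, and
    grad F (x) = 0. *)

(** * The bilinear form and commutative algebras with isotropic squares *)

Definition bdot {K : comNzRingType} {n} (x y : 'rV[K]_n) : K :=
  \sum_(i < n) x 0 i * y 0 i.

Section Dot.
Context {K : comNzRingType} {n : nat}.
Implicit Types x y z : 'rV[K]_n.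

Lemma bdotC x y : bdot x y = bdot y x.
Proof. by apply: eq_bigr => i _; rewrite mulrC. Qed.

Lemma bdotDl x y z : bdot (x + y) z = bdot x z + bdot y z.
Proof. by rewrite -big_split; apply: eq_bigr => i _; rewrite !mxE mulrDl. Qed.

Lemma bdotZl a x z : bdot (a *: x) z = a * bdot x z.
Proof. by rewrite mulr_sumr; apply: eq_bigr => i _; rewrite !mxE mulrA. Qed.

Lemma bdotDr x y z : bdot x (y + z) = bdot x y + bdot x z.
Proof. by rewrite bdotC bdotDl !(bdotC x). Qed.

Lemma bdotZr a x z : bdot x (a *: z) = a * bdot x z.
Proof. by rewrite bdotC bdotZl (bdotC x). Qed.

Lemma bdot0l z : bdot 0 z = 0.
Proof. by rewrite -(scale0r 0) bdotZl mul0r. Qed.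

Lemma bdot0r x : bdot x 0 = 0.
Proof. by rewrite bdotC bdot0l. Qed.

Lemma bdot_delta x i : bdot x (delta_mx 0 i) = x 0 i.
Proof.
rewrite /bdot (bigD1 i) //= !mxE !eqxx mulr1 big1 ?addr0 // => j ji.
by rewrite mxE (negbTE ji) andbF mulr0.
Qed.

Lemma bdot_eq0 x : (forall y, bdot x y = 0) -> x = 0.
Proof. by move=> h; apply/rowP => i; rewrite -bdot_delta h mxE. Qed.

End Dot.

(** The datum of m amounts to that of the symmetric trilinear form
    (x, y, z) |-> bdot (m x y) z. *)
Record metrized (K : comNzRingType) (n : nat)
    (m : 'rV[K]_n -> 'rV[K]_n -> 'rV[K]_n) : Prop := Metrized {
  metC : forall x y, m x y = m y x;
  metDr : forall x y z, m x (y + z) = m x y + m x z;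
  metZr : forall a x y, m x (a *: y) = a *: m x y;
  metB : forall x y z, bdot (m x y) z = bdot x (m y z) }.

Section NullSquares.
Context {K : numFieldType} {n : nat} {m : 'rV[K]_n -> 'rV[K]_n -> 'rV[K]_n}.
Context (mm : metrized m).
Context (sq_null : forall x, bdot (m x x) (m x x) = 0).
Implicit Types x y z u v w : 'rV[K]_n.

Let mC := metC mm.
Let mDr := metDr mm.
Let mZr := metZr mm.
Let mB := metB mm.

Let mDl x y z : m (x + y) z = m x z + m y z.
Proof. by rewrite mC mDr !(mC z). Qed.
Let mZl a x y : m (a *: x) y = a *: m x y.
Proof. by rewrite mC mZr (mC y). Qed.
Let mNr x y : m x (- y) = - m x y.
Proof. by rewrite -scaleN1r mZr scaleN1r. Qed.
Let m0r x : m x 0 = 0.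
Proof. by rewrite -(scale0r 0) mZr !scale0r. Qed.
Let mNl x y : m (- x) y = - m x y.
Proof. by rewrite mC mNr (mC y). Qed.
Let bil := (mDr, mDl, mNr, mNl, mZr, mZl).

Let two_neq0 : 2 != 0 :> K. Proof. by rewrite pnatr_eq0. Qed.

(** The part of <x x, x x> = 0 that is of degree 3 in x and 1 in y. The parts of
    odd degree in y are separated by evaluating at t y for t = 1 and t = 2. *)
Lemma sq_polar x y : bdot (m x x) (m x y) = 0.
Proof.
set D := bdot _ _.
have E : forall t : K, 8 * (t * D + t ^+ 3 * bdot (m x y) (m y y)) = 0.
  move=> t; have := sq_null (x + t *: y); have := sq_null (x - t *: y).
  rewrite -scaleNr !(mDr, mDl, mZr, mZl, bdotDl, bdotDr, bdotZl, bdotZr).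
  rewrite !sq_null (mC y x) (bdotC (m y y)) (bdotC (m x y) (m x x)).
  rewrite -/D (bdotC (m y y) (m x y)) => h1 h2.
  transitivity (0 - 0 : K); last by rewrite subr0.
  rewrite -[X in _ = X - _]h2 -[X in _ = _ - X]h1; ring.
have h1 := E 1; have h2 := E 2.
have /eqP : 48 * D = 0.
  transitivity (8 * 0 - 0 : K); last by ring.
  rewrite -[X in _ = _ * X - _]h1 -[X in _ = _ - X]h2; ring.
by rewrite mulf_eq0 pnatr_eq0 /= => /eqP.
Qed.

Lemma cube0 x : m x (m x x) = 0.
Proof. by apply: bdot_eq0 => y; rewrite mC mB sq_polar. Qed.

(** The part of the cubic identity that is linear in x and quadratic in y. *)
Lemma mul_sq x y : m x (m y y) = - 2 *: m y (m x y).
Proof.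
have := cube0 (x + y); have := cube0 (y - x).
rewrite !bil !cube0 !(mC y x) => /rowP h1 /rowP h2; apply/rowP => k.
have := h1 k; have := h2 k; rewrite !mxE => {}h2 {}h1.
apply: (mulfI two_neq0); apply/eqP; rewrite -subr_eq0; apply/eqP.
by rewrite -[RHS](subr0 0) -[X in _ = X - _]h2 -[X in _ = _ - X]h1; ring.
Qed.

(** The full polarization of x (x x) = 0. *)
Lemma mul_cyc x y z : m x (m y z) + m y (m z x) + m z (m x y) = 0.
Proof.
have := mul_sq x (y + z); rewrite !bil !mul_sq (mC z y) (mC z x).
move=> /rowP h; apply/rowP => k; have /eqP := h k.
rewrite -subr_eq0 !mxE => /eqP {}h.
by apply: (mulfI two_neq0); rewrite mulr0 -h; ring.
Qed.

(** The cyclic identity for y y, y, x reduces to - 4 y (y (y x)) = 0, since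
    y y and y multiply to 0. *)
Lemma mul3_eq0 y x : m y (m y (m y x)) = 0.
Proof.
have := mul_cyc (m y y) y x; rewrite (mC y (m x _)) (mC (m x _)) !mul_sq.
rewrite (mC _ (m y x)) mul_sq (mC (m y x)) (mC (m y y) y) cube0 m0r addr0.
rewrite (mC x y) !mZr => /rowP h; apply/rowP => k; have := h k; rewrite !mxE.
move=> {}h; apply: (mulfI two_neq0); apply: (mulfI two_neq0).
rewrite !mulr0 -[RHS]oppr0 -h; ring.
Qed.

Section Chain.
Context (y z : 'rV[K]_n).
Let e := m y y.
Let p := m y z.
Let q := m y p.
Context (q_neq0 : q != 0).

Let ye : m y e = 0. Proof. exact: cube0. Qed.
Let yq : m y q = 0. Proof. exact: mul3_eq0. Qed.
Let ze : m z e = - 2 *: q. Proof. by rewrite mul_sq (mC z). Qed.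
Let pe : m p e = 0. Proof. by rewrite mul_sq (mC p) -/q yq scaler0. Qed.
Let qe : m q e = 0. Proof. by rewrite mul_sq (mC q) yq m0r scaler0. Qed.
Let ee : m e e = 0. Proof. by rewrite mul_sq (mC e) ye m0r scaler0. Qed.

(* The multiplication by z is nilpotent, so its only eigenvalue is 0. *)
Let z_eigen c : m z q = c *: q -> c = 0.
Proof.
move=> h; have := mul3_eq0 z q; rewrite h !mZr h !mZr h !scalerA => /eqP.
by rewrite scaler_eq0 (negbTE q_neq0) orbF !mulf_eq0 !orbb => /eqP.
Qed.

(* If q and e were proportional, z e = - 2 q would make q an eigenvector of z
   for a nonzero eigenvalue. *)
Let qe_free s t : s *: q + t *: e = 0 -> s = 0 /\ t = 0.
Proof.
move=> h; have := congr1 (m z) h; rewrite !bil m0r ze => h1.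
have s0 : s = 0.
  apply/eqP; case: (eqVneq s 0) => // s_neq0.
  have : 2 * t / s = 0.
    apply: z_eigen; apply: (scalerI s_neq0); rewrite scalerA.
    move/eqP: h1; rewrite addr_eq0 => /eqP ->.
    by rewrite -scaleNr scalerA; congr (_ *: _); field.
  move/eqP; rewrite !mulf_eq0 (negbTE two_neq0) invr_eq0 (negbTE s_neq0) orbF /=.
  move=> /eqP t0; move/eqP: h; rewrite t0 scale0r addr0 scaler_eq0.
  by rewrite (negbTE q_neq0) (negbTE s_neq0).
split=> //; move/eqP: h1; rewrite s0 scale0r add0r scalerA scaler_eq0.
rewrite (negbTE q_neq0) orbF mulf_eq0 oppr_eq0 (negbTE two_neq0) orbF.
by move/eqP.
Qed.

(** Multiplying by y sends the chains z, p, q and y, e one step down, so two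
    such multiplications isolate the coefficient of z. *)
Lemma chain_free a b c d k :
  a *: z + b *: p + c *: q + d *: y + k *: e = 0 ->
  [/\ a = 0, b = 0, c = 0, d = 0 & k = 0].
Proof.
move=> h; have := congr1 (m y) h; rewrite !bil m0r ye yq !scaler0 !addr0 => h1.
have := congr1 (m y) h1; rewrite !bil m0r ye yq !scaler0 !addr0 => /eqP.
rewrite scaler_eq0 (negbTE q_neq0) orbF => /eqP a0.
move: h1 h; rewrite a0 !scale0r !add0r => /qe_free[-> ->].
by rewrite !scale0r addr0 add0r => /qe_free[-> ->].
Qed.

Lemma chain_span (n_le5 : (n <= 5)%N) x :
  exists a b c d k, x = a *: z + b *: p + c *: q + d *: y + k *: e.
Proof.
pose M := \matrix_(i < 5) nth 0 [:: z; p; q; y; e] i.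
have E (u : 'rV[K]_5) : u *m M = u 0 0 *: z + u 0 1 *: p + u 0 2%:R *: q
    + u 0 3%:R *: y + u 0 4%:R *: e.
  rewrite mulmx_sum_row !big_ord_recl big_ord0 addr0 !rowK /= !addrA.
  by do ![congr (_ + _)]; congr (u _ _ *: _); apply: val_inj.
have Mfree : row_free M.
  apply: inj_row_free => u; rewrite E => /chain_free[u0 u1 u2 u3 u4].
  apply/rowP => i; rewrite mxE.
  case: i => [[|[|[|[|[|//]]]]] lt_i]; [rewrite -[RHS]u0|rewrite -[RHS]u1
    |rewrite -[RHS]u2|rewrite -[RHS]u3|rewrite -[RHS]u4];
    by congr (u _ _); apply: val_inj.
have Mfull : row_full M.
  rewrite /row_full eqn_leq rank_leq_col /=.
  by move/eqP: Mfree => ->.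
have /submxP[u ->] := submx_full x Mfull.
by exists (u 0 0), (u 0 1), (u 0 2%:R), (u 0 3%:R), (u 0 4%:R); rewrite E.
Qed.

(** Expanding z z in the basis z, p, q, y, e, nilpotency kills its coefficient
    of z, and z (z z) = 0 its coefficient of y. The remaining basis vectors
    p, q, e are orthogonal to e, so <z z, e> = 0; this is the value, up to a
    factor, of <q, z>, the only product of q with the basis that does not
    vanish by associativity, y q = 0 and y e = 0. *)
Lemma chain_absurd (n_le5 : (n <= 5)%N) : False.
Proof.
have [a [b [c [d [k Er]]]]] := chain_span n_le5 (m z z).
have er : m e (m z z) = (- 2 * a) *: q.
  rewrite Er !bil (mC e z) ze (mC e p) pe (mC e q) qe (mC e y) ye ee.
  by rewrite !scaler0 !addr0 scalerA mulrC.
have zq : m z q = (- a / 2) *: q.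
  have := er; rewrite mul_sq (mC e) ze mZr scalerA => h.
  have -> : m z q = 4^-1 *: (4 *: m z q).
    by rewrite scalerA mulVf ?scale1r // pnatr_eq0.
  have -> : 4 = - 2 * - 2 :> K by ring.
  rewrite h scalerA; congr (_ *: _); field; by rewrite ?pnatr_eq0.
have a0 : a = 0.
  by have /eqP := z_eigen zq; rewrite mulf_eq0 oppr_eq0 invr_eq0 (negbTE two_neq0)
     orbF => /eqP.
move: er zq Er; rewrite a0 mulr0 oppr0 mul0r !scale0r add0r => er zq Er.
have d0 : d = 0.
  (* y times the identity z (z z) = 0 leaves only d q. *)
  have h := cube0 z; move: h; rewrite Er !bil zq scaler0 addr0 ze (mC z y) -/p.
  move=> h; have := congr1 (m y) h.
  rewrite !bil m0r yq !scaler0 addr0 -/q.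
  have -> : m y (m z p) = 0.
    have := mul_sq (m z z) y; rewrite mC er (mC (m z z)) (mul_sq y z) mZr -/p.
    move/esym/eqP; rewrite !scaler_eq0 oppr_eq0 (negbTE two_neq0) /=.
    by move/eqP.
  rewrite scaler0 add0r => /eqP.
  by rewrite scaler_eq0 (negbTE q_neq0) orbF => /eqP.
(* e is orthogonal to all multiples of y because y e = 0. *)
have de x : bdot (m y x) e = 0 by rewrite (mC y) mB ye bdot0r.
have qd x : bdot q (m y x) = 0 by rewrite -mB (mC q) yq bdot0l.
have re : bdot (m z z) e = 0.
  by rewrite Er d0 !(bdotDl, bdotZl) !de mul0r !mulr0 !addr0.
have qz : bdot q z = 0.
  apply: (mulfI two_neq0); apply: (@mulfI _ (-1)); first by rewrite oppr_eq0 oner_eq0.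
  by rewrite mulrA mulN1r -bdotZl -ze (mC z) mB bdotC re !mulr0.
have qy : bdot q y = 0 by rewrite (mC y p : q = _) mB bdotC (bdotC (m y y)) de.
have qx x : bdot q x = 0.
  have [a1 [b1 [c1 [d1 [k1 ->]]]]] := chain_span n_le5 x.
  by rewrite !(bdotDr, bdotZr) qz qy !qd !mulr0 !addr0.
move/eqP: q_neq0; apply; exact: bdot_eq0.
Qed.

End Chain.

Lemma mul_mul_eq0 (n_le5 : (n <= 5)%N) x y z : m x (m y z) = 0.
Proof.
have sq0 w : m x (m w w) = 0.
  rewrite mul_sq (mC x); apply/eqP; rewrite scaler_eq0; apply/orP; right.
  by apply/negPn/negP => q_neq0; exact: chain_absurd q_neq0 n_le5.
have := sq0 (y + z); rewrite !bil !sq0 add0r addr0 (mC z y) => /eqP.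
by rewrite -mulr2n -scaler_nat scaler_eq0 (negbTE two_neq0) => /eqP.
Qed.

Lemma bdot_mul_mul (n_le5 : (n <= 5)%N) x y z w : bdot (m x y) (m z w) = 0.
Proof. by rewrite mB mul_mul_eq0 ?bdot0r. Qed.

End NullSquares.

Local Open Scope complex_scope.

(** * Real vectors orthogonal to an isotropic family *)

(** A matrix G with G G^T = 0 and 5 columns has rank at most 2, so the real and
    imaginary parts of a basis of its row space are at most 4 real linear forms
    in 5 unknowns. *)
Lemma real_orth_isotropic (R : rcfType) (I : finType) (g : I -> 'rV[R[i]]_5) :
  (forall i j, bdot (g i) (g j) = 0) ->
  exists2 x : 'rV[R]_5,
    x != 0 & forall i, bdot (g i) (map_mx (real_complex R) x) = 0.
Proof.
move=> gg0; pose G := \matrix_(l < #|I|) g (enum_val l).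
have GG0 : G *m G^T = 0.
  apply/matrixP => k l; rewrite !mxE -[RHS](gg0 (enum_val k) (enum_val l)).
  by apply: eq_bigr => j _; rewrite !mxE.
have rG : (\rank G <= 2)%N.
  by have := mulmx0_rank_max GG0; rewrite mxrank_tr addnn; case: (\rank G) => [|[|[|]]].
have : G *m G^T = 0 -> (G <= row_base G)%MS by rewrite eq_row_base.
move: (row_base G) => B /(_ GG0) GB.
pose Br := map_mx (@complex.Re R) B; pose Bi := map_mx (@complex.Im R) B.
pose N := kermx (row_mx Br^T Bi^T).
have N_neq0 : N != 0.
  rewrite -mxrank_eq0 mxrank_ker subn_eq0 -ltnNge ltnS.
  apply: leq_trans (rank_leq_col _) _.
  by rewrite addnn -[4%N]/(2.*2)%N leq_double.
have [x x_neq0 xN] : exists2 x : 'rV_5, x != 0 & x *m row_mx Br^T Bi^T = 0.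
  have /rowV0Pn[x xN x_neq0] := N_neq0.
  by exists x => //; apply/sub_kermxP.
exists x => // i.
move/eqP: xN; rewrite mul_mx_row row_mx_eq0 => /andP[/eqP hr /eqP hi].
have Bx0 : B *m (map_mx (real_complex R) x)^T = 0.
  apply: trmx_inj; rewrite trmx_mul trmxK trmx0; apply/rowP => j.
  have hr' := congr1 (fun M : 'rV_ _ => M 0 j) hr.
  have hi' := congr1 (fun M : 'rV_ _ => M 0 j) hi.
  rewrite !mxE in hr' hi' *.
  transitivity ((\sum_l x 0 l * Br^T l j) +i* (\sum_l x 0 l * Bi^T l j));
    last by rewrite hr' hi'.
  elim/big_rec3: _ => // l c b a _ ->.
  by rewrite !mxE; case: (B j l) => u v /=; simpc.
have /submxP[D GE] := GB.
have Gx0 : G *m (map_mx (real_complex R) x)^T = 0 by rewrite GE -mulmxA Bx0 mulmx0.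
have := congr1 (fun M : 'cV_ _ => M (enum_rank i) 0) Gx0.
rewrite !mxE => Gx; rewrite -[RHS]Gx; apply: eq_bigr => j _.
by rewrite !mxE enum_rankK.
Qed.

(** * Homogeneous polynomials and their real critical points *)

Section MultivariatePolynomials.
Import -(notations) mpoly.
Context {n : nat} {K : comNzRingType}.
Implicit Types (p q : mpoly n K) (i j : 'I_n).

(** The polynomial ring is generated as an algebra by the variables; this form
    of induction suits statements about evaluation and derivatives, which are
    compatible with products. *)
Lemma mpoly_alg_ind (P : mpoly n K -> Prop) :
  (forall c, P (mpolyC n c)) -> (forall i, P (mpolyX K (mnm1 i))) ->
  (forall p q, P p -> P q -> P (p + q)) ->
  (forall p q, P p -> P q -> P (p * q)) -> forall p, P p.
Proof.
move=> PC PX PD PM p; rewrite [p]mpolyE.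
apply: (big_ind P) => [|//|m _]; first by rewrite -(mpolyC0 n); exact: PC.
rewrite -mul_mpolyC; apply: (PM _ _ (PC _)).
rewrite mpolyXE_id; apply: (big_ind P) => [|//|i _].
  by rewrite -(mpolyC1 n); exact: PC.
elim: (m i) => [|k IH]; first by rewrite expr0 -(mpolyC1 n); exact: PC.
by rewrite exprS; apply: PM.
Qed.

Lemma mderiv_homog d p i :
  p \is ishomog1 d.+1 mdeg -> mderiv i p \is ishomog1 d mdeg.
Proof.
move=> /dhomogP hp; apply/dhomogP => m; rewrite mcoeff_msupp mcoeff_deriv => h.
have : mnm_add m (mnm1 i) \in msupp p.
  rewrite mcoeff_msupp; apply: contra h => /eqP ->; by rewrite mul0rn.
by move=> /hp; rewrite /= mdegD mdeg1 addn1 => -[].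
Qed.

Lemma homog0_meval p (v w : 'I_n -> K) :
  p \is ishomog1 0 mdeg -> meval v p = meval w p.
Proof.
move=> /dhomogP hp; rewrite !mevalE !big_seq; apply: eq_bigr => m /hp.
move=> /eqP; rewrite mdeg_eq0 => /eqP ->.
by rewrite !big1 // => i _; rewrite mnm0E expr0.
Qed.

Lemma homog_scale d p a (v : 'I_n -> K) : p \is ishomog1 d mdeg ->
  meval (fun i => a * v i) p = a ^+ d * meval v p.
Proof.
move=> /dhomogP hp; rewrite !mevalE mulr_sumr !big_seq.
apply: eq_bigr => m /hp dm; rewrite -(dm : mdeg m = d) mulrCA; congr (_ * _).
rewrite mdegE -prodrXr -big_split.
by apply: eq_bigr => i _; rewrite exprMn.
Qed.

Lemma euler_homog d p (v : 'I_n -> K) : p \is ishomog1 d mdeg ->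
  \sum_i v i * meval v (mderiv i p) = d%:R * meval v p.
Proof.
move=> /dhomogP hp.
have E i : meval v (mderiv i p) =
    \sum_(m <- msupp p) mcoeff m p * meval v (mderiv i (mpolyX K m)).
  rewrite {1}[p]mpolyE (raddf_sum (mderiv i)) (raddf_sum (meval v)).
  apply: eq_bigr => m _ /=.
  by rewrite mderivZ mevalZ.
have Ep : meval v p = \sum_(m <- msupp p) mcoeff m p * meval v (mpolyX K m).
  rewrite {1}[p]mpolyE (raddf_sum (meval v)).
  by apply: eq_bigr => m _ /=; rewrite mevalZ.
under eq_bigr do rewrite E mulr_sumr.
rewrite exchange_big /= Ep mulr_sumr !big_seq.
apply: eq_bigr => m /hp dm; rewrite -(dm : mdeg m = d) mdegE natr_sum mulr_suml.
apply: eq_bigr => i _; rewrite mulrCA [RHS]mulrCA; congr (_ * _).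
rewrite mderivX mevalZ mulrCA; case: (posnP (m i)) => [->|mi_gt0].
  by rewrite !mul0r.
congr (_ * _); rewrite -{1}(mevalXU v i) -mevalM -mpolyXD addmC submK //.
by apply/mnm_lepP => j; rewrite mnm1E; case: eqP => // <-.
Qed.

Definition pgrad p (x : 'rV[K]_n) : 'rV[K]_n :=
  \row_k meval (x 0) (mderiv k p).

(** Taken at the origin because it will be used in degree 2, where the second
    derivatives are constant. *)
Definition hessian_at0 p : 'M[K]_n :=
  \matrix_(i, k) meval (fun=> 0) (mderiv i (mderiv k p)).

(** The symmetric trilinear form D^3 p at the origin, turned into a product by
    the bilinear form. *)
Definition polar_product p (x y : 'rV[K]_n) : 'rV[K]_n :=
  \row_k \sum_i \sum_j x 0 i * y 0 j
    * meval (fun=> 0) (mderiv i (mderiv j (mderiv k p))).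

Lemma polar_product_metrized p : metrized (polar_product p).
Proof.
split=> [x y|x y z|a x y|x y z].
- apply/rowP => k; rewrite !mxE exchange_big /=.
  apply: eq_bigr => i _; apply: eq_bigr => j _.
  by rewrite mderiv_comm (mulrC (y 0 i)).
- apply/rowP => k; rewrite !mxE -big_split; apply: eq_bigr => i _ /=.
  by rewrite -big_split; apply: eq_bigr => j _; rewrite !mxE mulrDr mulrDl.
- apply/rowP => k; rewrite !mxE mulr_sumr; apply: eq_bigr => i _ /=.
  by rewrite mulr_sumr; apply: eq_bigr => j _; rewrite !mxE; ring.
- pose c i j k := meval (fun=> 0) (mderiv i (mderiv j (mderiv k p))).
  transitivity (\sum_i \sum_j \sum_k x 0 i * y 0 j * z 0 k * c i j k).
    rewrite /bdot; under eq_bigr => k _.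
      rewrite mxE mulr_suml; under eq_bigr => i _ do rewrite mulr_suml.
      over.
    rewrite exchange_big; apply: eq_bigr => i _; rewrite exchange_big.
    by apply: eq_bigr => j _; apply: eq_bigr => k _; rewrite -/(c i j k); ring.
  apply: eq_bigr => i _; rewrite mxE mulr_sumr; apply: eq_bigr => j _.
  rewrite mulr_sumr; apply: eq_bigr => k _.
  by rewrite (mderiv_comm i k) (mderiv_comm i j) -/(c i j k); ring.
Qed.

Lemma polar_productE p x : p \is ishomog1 3 mdeg -> polar_product p x x = 2 *: pgrad p x.
Proof.
move=> hp; apply/rowP => k; rewrite !mxE.
have h2 := mderiv_homog k hp; rewrite -(euler_homog _ h2).
apply: eq_bigr => i _; have h1 := mderiv_homog i h2.
have := euler_homog (x 0) h1; rewrite mul1r => <-; rewrite mulr_sumr.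
apply: eq_bigr => j _; rewrite mulrA mderiv_comm; congr (_ * _).
exact: homog0_meval (mderiv_homog j h1).
Qed.

Lemma hessian_at0E p x : p \is ishomog1 2 mdeg -> x *m hessian_at0 p = pgrad p x.
Proof.
move=> hp; apply/rowP => k; rewrite !mxE.
have h1 := mderiv_homog k hp; have := euler_homog (x 0) h1; rewrite mul1r => <-.
apply: eq_bigr => i _; rewrite mxE; congr (_ * _).
exact: homog0_meval (mderiv_homog i h1).
Qed.

End MultivariatePolynomials.

Section RealPoints.
Import -(notations) mpoly.
Context {R : rcfType} {n : nat}.

Lemma poly_real_eq0 (P : {poly R[i]}) : (forall t : R, P.[t%:C] = 0) -> P = 0.
Proof.
move=> h; apply: (@roots_geq_poly_eq0 _ _ [seq k%:R | k <- iota 0 (size P)]).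
- by apply/allP => _ /mapP[k _ ->]; rewrite /root -(rmorph_nat (real_complex R)) h.
- rewrite map_inj_uniq ?iota_uniq // => a b /eqP; rewrite eqr_nat; exact: eqP.
- by rewrite size_map size_iota.
Qed.

(** On the complex line t |-> Re z + t Im z the polynomial restricts to a
    one-variable polynomial with infinitely many roots, the real numbers; its
    value at t = i is the value at z. *)
Lemma meval_real_eq0 (p : mpoly n R[i]) :
  (forall x : 'rV[R]_n, meval (fun i => (x 0 i)%:C) p = 0) ->
  forall z, meval z p = 0.
Proof.
move=> h z.
pose c i : {poly R[i]} := (complex.Re (z i))%:C%:P + (complex.Im (z i))%:C *: 'X.
pose P : {poly R[i]} := mmap (@polyC R[i]) c p.
have PE s : P.[s] = meval (fun i => (c i).[s]) p.
  rewrite /P; move: p {h P}; apply: mpoly_alg_ind => [a|i|p q hp hq|p q hp hq].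
  - by rewrite mmapC mevalC hornerC.
  - by rewrite mmapX mmap1U mevalXU.
  - by rewrite mmapD mevalD hornerD hp hq.
  - by rewrite rmorphM mevalM hornerM hp hq.
have P0 : P = 0.
  apply: poly_real_eq0 => t; rewrite PE.
  rewrite -[RHS](h (\row_i (complex.Re (z i) + complex.Im (z i) * t))).
  by apply: meval_eq => i; rewrite !hornerE mxE rmorphD rmorphM.
rewrite -[RHS](horner0 'i) -P0 PE; apply: meval_eq => i.
by rewrite !hornerE; case: (z i) => a b; simpc.
Qed.

End RealPoints.

Section RealCriticalPoint.
Import -(notations) mpoly.
Context {R : rcfType} (F : mpoly 5 R[i]).
Context (grad_null : forall x, bdot (pgrad F x) (pgrad F x) = 0).

Let two_neq0 : 2 != 0 :> R[i]. Proof. by rewrite pnatr_eq0. Qed.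

(** The rows of the Hessian H are gradients, and polarization makes them
    mutually orthogonal. *)
Lemma critical_point_quadratic : F \is ishomog1 2 mdeg ->
  exists2 x : 'rV[R]_5, x != 0 & pgrad F (map_mx (real_complex R) x) = 0.
Proof.
move=> hF.
have gg i j : bdot (row i (hessian_at0 F)) (row j (hessian_at0 F)) = 0.
  have rE l : row l (hessian_at0 F) = pgrad F (delta_mx 0 l).
    by rewrite -hessian_at0E // -rowE.
  have := grad_null (delta_mx 0 i + delta_mx 0 j).
  rewrite -!(hessian_at0E _ hF) !mulmxDl -!rowE !(bdotDl, bdotDr) !rE !grad_null -!rE.
  rewrite add0r addr0 (bdotC (row j _)) -mulr2n -mulr_natl => /eqP.
  by rewrite mulf_eq0 (negbTE two_neq0) => /eqP.
have [x x_neq0 hx] := real_orth_isotropic gg; exists x => //.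
rewrite -hessian_at0E //; apply/rowP => k; rewrite !mxE -[RHS](hx k).
by apply: eq_bigr => i _; rewrite !mxE mderiv_comm mulrC.
Qed.

(** The products of basis vectors span an isotropic space, and x x = 0 as soon
    as x is orthogonal to it. *)
Lemma critical_point_cubic : F \is ishomog1 3 mdeg ->
  exists2 x : 'rV[R]_5, x != 0 & pgrad F (map_mx (real_complex R) x) = 0.
Proof.
move=> hF; have mF := polar_product_metrized F.
have sq0 x : bdot (polar_product F x x) (polar_product F x x) = 0.
  by rewrite polar_productE // bdotZl bdotZr grad_null !mulr0.
pose g (ij : 'I_5 * 'I_5) := polar_product F (delta_mx 0 ij.1) (delta_mx 0 ij.2).
have gg i j : bdot (g i) (g j) = 0 by exact: bdot_mul_mul.
have [x x_neq0 hx] := real_orth_isotropic gg; exists x => //.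
set xc := map_mx _ x.
apply: (scalerI two_neq0); rewrite -polar_productE // scaler0; apply/rowP => k.
rewrite -bdot_delta metB // mxE.
have D i : bdot (delta_mx 0 i) (polar_product F xc (delta_mx 0 k)) = 0.
  by rewrite (metC mF xc) -(metB mF) -[RHS](hx (i, k)).
rewrite /bdot big1 // => i _.
by rewrite -[X in _ * X]bdot_delta bdotC D mulr0.
Qed.

End RealCriticalPoint.

(** * Real derivatives of polynomial functions *)

Section Derivatives.
Context {R : realType} {n : nat}.
Implicit Types (x v : 'rV[R]_n) (F : mpoly.mpoly n R[i]).

Lemma is_derive_coord x v (i : 'I_n) : is_derive x v (fun y => y 0 i) (v 0 i).
Proof.
have [d e] : is_derive x v (id : 'rV[R]_n -> 'rV[R]_n) v by exact: is_derive_id.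
split; first exact: (derivable_mxP id x v).1 d 0 i.
by rewrite -[in RHS]e derive_mx // mxE.
Qed.

Definition dpolyfun F x v : R[i] :=
  \sum_j (v 0 j)%:C * polyfun (mpoly.mderiv j F) x.

Lemma is_derive_polyfun F x v :
  is_derive x v (fun y => complex.Re (polyfun F y)) (complex.Re (dpolyfun F x v)) /\
  is_derive x v (fun y => complex.Im (polyfun F y)) (complex.Im (dpolyfun F x v)).
Proof.
move: F; apply: mpoly_alg_ind => [c|i|p q [hp1 hp2] [hq1 hq2]|p q [hp1 hp2] [hq1 hq2]].
- rewrite /dpolyfun; under eq_bigr do rewrite mpoly.mderivC /polyfun mpoly.meval0 mulr0.
  rewrite big1 //; split.
  + rewrite (_ : (fun _ => _) = cst (complex.Re c)); first exact: is_derive_cst.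
    by apply/funext => y; rewrite /polyfun mpoly.mevalC.
  + rewrite (_ : (fun _ => _) = cst (complex.Im c)); first exact: is_derive_cst.
    by apply/funext => y; rewrite /polyfun mpoly.mevalC.
- have -> : dpolyfun (mpoly.mpolyX R[i] (mpoly.mnm1 i)) x v = (v 0 i)%:C.
    rewrite /dpolyfun (bigD1 i) //= big1 ?addr0 => [|j ji].
      rewrite /polyfun mpoly.mderivX mpoly.mevalZ mpoly.mnm1E eqxx mul1r.
      by rewrite mpoly.mevalX big1 ?mulr1 // => k _; rewrite mpoly.mnmBE subnn expr0.
    by rewrite /polyfun mpoly.mderivX mpoly.mevalZ mpoly.mnm1E eq_sym
      (negbTE ji) mul0r mulr0.
  split.
  + rewrite (_ : (fun _ => _) = (fun y : 'rV[R]_n => y 0 i)); first exact: is_derive_coord.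
    by apply/funext => y; rewrite /polyfun mpoly.mevalXU.
  + rewrite (_ : (fun _ => _) = cst 0); first exact: is_derive_cst.
    by apply/funext => y; rewrite /polyfun mpoly.mevalXU.
- have -> : dpolyfun (p + q) x v = dpolyfun p x v + dpolyfun q x v.
    rewrite /dpolyfun -big_split; apply: eq_bigr => j _ /=.
    by rewrite mpoly.mderivD /polyfun mpoly.mevalD mulrDr.
  split.
  + rewrite (_ : (fun _ => _) = (fun y => complex.Re (polyfun p y)) +
                              (fun y => complex.Re (polyfun q y))).
      apply: is_derive_eq (is_deriveD hp1 hq1) _.
      by case: (dpolyfun p x v) (dpolyfun q x v) => ? ? [].
    apply/funext => y; rewrite !fctE /polyfun mpoly.mevalD.
    by case: (mpoly.meval _ p) (mpoly.meval _ q) => ? ? [].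
  + rewrite (_ : (fun _ => _) = (fun y => complex.Im (polyfun p y)) +
                              (fun y => complex.Im (polyfun q y))).
      apply: is_derive_eq (is_deriveD hp2 hq2) _.
      by case: (dpolyfun p x v) (dpolyfun q x v) => ? ? [].
    apply/funext => y; rewrite !fctE /polyfun mpoly.mevalD.
    by case: (mpoly.meval _ p) (mpoly.meval _ q) => ? ? [].
- have -> : dpolyfun (p * q) x v = polyfun q x * dpolyfun p x v +
      polyfun p x * dpolyfun q x v.
    rewrite /dpolyfun !mulr_sumr -big_split; apply: eq_bigr => j _ /=.
    by rewrite mpoly.mderivM /polyfun mpoly.mevalD !mpoly.mevalM; ring.
  have := is_deriveM hp1 hq1; have := is_deriveM hp2 hq2.
  have := is_deriveM hp1 hq2; have := is_deriveM hp2 hq1.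
  move=> h1 h2 h3 h4; split.
  + rewrite (_ : (fun _ => _) = (fun y => complex.Re (polyfun p y)) *
        (fun y => complex.Re (polyfun q y)) - (fun y => complex.Im (polyfun p y)) *
        (fun y => complex.Im (polyfun q y))).
      apply: is_derive_eq (is_deriveB h4 h3) _.
      case: (dpolyfun p x v) (dpolyfun q x v) (polyfun p x) (polyfun q x)
        => a b [c d] [e f] [g h] /=.
      by rewrite /GRing.scale /=; ring.
    apply/funext => y; rewrite !fctE /polyfun mpoly.mevalM.
    by case: (mpoly.meval _ p) (mpoly.meval _ q) => ? ? [].
  + rewrite (_ : (fun _ => _) = (fun y => complex.Re (polyfun p y)) *
        (fun y => complex.Im (polyfun q y)) + (fun y => complex.Im (polyfun p y)) *
        (fun y => complex.Re (polyfun q y))).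
      apply: is_derive_eq (is_deriveD h2 h1) _.
      case: (dpolyfun p x v) (dpolyfun q x v) (polyfun p x) (polyfun q x)
        => a b [c d] [e f] [g h] /=.
      by rewrite /GRing.scale /=; ring.
    apply/funext => y; rewrite !fctE /polyfun mpoly.mevalM.
    by case: (mpoly.meval _ p) (mpoly.meval _ q) => ? ? [].
Qed.

Lemma cderive_polyfun F v x : cderive (polyfun F) v x = dpolyfun F x v.
Proof.
have [h1 h2] := is_derive_polyfun F x v.
by rewrite /cderive !derive_val; case: (dpolyfun F x v).
Qed.

End Derivatives.

(** * Extension off the sphere at a critical point *)

Section Sphere.
Context {R : realType} {n : nat}.
Implicit Types (x v : 'rV[R]_n) (F : mpoly.mpoly n R[i]).

(** The difference quotient of h G is h times the one of G, as G x = 0; thus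
    continuity of h is enough and the norm need not be differentiated. *)
Lemma derive_vanishing_mul (h G : 'rV[R]_n -> R) x v :
  {for x, continuous h} -> G x = 0 -> is_derive x v G 0 ->
  'D_v (h * G) x = 0.
Proof.
move=> ch Gx0 [dG eG]; apply/cvg_lim => //.
rewrite -[0 as X in _ --> X](mulr0 (h x)).
have E : (fun t => t^-1 *: (((h * G) \o shift x) (t *: v) - (h * G) x)) =
   (fun t : R => h (t *: v + x) * (t^-1 *: ((G \o shift x) (t *: v) - G x))).
  apply/funext => t; rewrite /= !fctE Gx0 mulr0 !subr0 /GRing.scale /=.
  by rewrite mulrCA.
have dG' : (fun t => t^-1 *: ((G \o shift x) (t *: v) - G x)) @ (0:R)^' --> 'D_v G x.
  exact: dG.
rewrite E; apply: cvgM; last by rewrite eG in dG'.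
apply: (@cvg_comp _ _ _ (fun t : R => t *: v + x) h _ (nbhs x)); last exact: ch.
apply: cvg_within_filter.
have : (fun t : R => t *: v + x) @ (0:R) --> 0 *: v + x.
  by apply: cvgD; [apply: cvgZr_tmp; exact: cvg_id | exact: cvg_cst].
by rewrite scale0r add0r.
Qed.

Lemma enorm_continuous : continuous (@enorm R n).
Proof.
move=> x; pose S (y : 'rV[R]_n) : R := \sum_i y 0 i ^+ 2.
have cS : continuous S.
  apply: continuous_big => [|i _ y]; first exact: add_continuous.
  rewrite (_ : (fun _ => _) = (fun y : 'rV[R]_n => y 0 i * y 0 i));
    last by apply/funext => z; rewrite expr2.
  have c := @coord_continuous R 1 n 0 i y.
  exact: (cvgM c c).
exact: (continuous_comp (cS x) (@sqrt_continuous R (S x))).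
Qed.

Lemma enorm_scale (a : R) x : enorm (a *: x) = `|a| * enorm x.
Proof.
rewrite /enorm -sqrtr_sqr -sqrtrM ?sqr_ge0 // mulr_sumr; congr Num.sqrt.
by apply: eq_bigr => i _; rewrite mxE exprMn.
Qed.

Lemma enorm_gt0 x : (0 < enorm x) = (x != 0).
Proof.
have sq_ge0 i : true -> 0 <= x 0 i ^+ 2 by rewrite sqr_ge0.
rewrite /enorm sqrtr_gt0 lt_def sumr_ge0 // andbT psumr_eq0 //.
congr (~~ _); apply/allP/eqP => [h|-> i _]; last by rewrite mxE expr0n eqxx.
apply/rowP => i; rewrite mxE; have /= := h i (mem_index_enum _).
by rewrite sqrf_eq0 => /eqP.
Qed.

Lemma enorm_unit x : x != 0 -> enorm ((enorm x)^-1 *: x) = 1.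
Proof.
rewrite -enorm_gt0 => x_gt0; rewrite enorm_scale ger0_norm ?invr_ge0 ?(ltW x_gt0) //.
by rewrite mulVf // gt_eqF.
Qed.

Lemma polyfun_scale d F (a : R) x : F \is @mpoly.ishomog1 n R[i] d mpoly.mdeg ->
  polyfun F (a *: x) = (a ^+ d)%:C * polyfun F x.
Proof.
move=> hF; rewrite rmorphXn /= -(homog_scale _ _ hF); apply: mpoly.meval_eq => i.
by rewrite mxE rmorphM.
Qed.

(** Near x the extension of f off the sphere is y |-> |y|^-d F(y), by
    homogeneity. *)
Lemma tderive_critical d F (f : 'rV[R]_n -> R[i]) v x :
  F \is @mpoly.ishomog1 n R[i] d mpoly.mdeg ->
  (forall y, carrier (sphere R n) y -> f y = polyfun F y) ->
  x != 0 -> polyfun F x = 0 -> pgrad F (map_mx (real_complex R) x) = 0 ->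
  tderive (sphere R n) f v x = 0.
Proof.
move=> hF fF x_neq0 Fx0 gradFx0.
have dF : dpolyfun F x v = 0.
  rewrite /dpolyfun big1 // => j _.
  have := congr1 (fun M : 'rV_ _ => M 0 j) gradFx0; rewrite !mxE => h.
  rewrite -[RHS](mulr0 (v 0 j)%:C) -h; congr (_ * _).
  by apply: mpoly.meval_eq => k; rewrite mxE.
have [] := is_derive_polyfun F x v; rewrite dF /= => dRe dIm.
pose h (y : 'rV[R]_n) : R := (enorm y)^-1 ^+ d.
have ch : {for x, continuous h}.
  apply: (@continuous_comp _ _ _ (fun y : 'rV[R]_n => (enorm y)^-1) (fun s => s ^+ d));
    last exact: exprn_continuous.
  have x_gt0 : enorm x != 0 by rewrite lt0r_neq0 // enorm_gt0.
  exact: (cvgV x_gt0 (@enorm_continuous x)).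
have near_x : \forall y \near x, f (retr (sphere R n) y) = (h y)%:C * polyfun F y.
  have : \forall y \near x, 0 < enorm y.
    by apply: (cvgr_gt _ (@enorm_continuous x)); rewrite enorm_gt0.
  apply: filterS => y; rewrite enorm_gt0 => y_neq0.
  by rewrite fF ?(polyfun_scale _ _ hF) //; exact: enorm_unit.
rewrite /tderive /cderive.
have -> : 'D_v (fun y => complex.Re ((f \o retr (sphere R n)) y)) x = 0.
  rewrite -(derive_vanishing_mul ch (G := fun y => complex.Re (polyfun F y)) _
    dRe) ?Fx0 //.
  apply: near_eq_derive; apply: filterS near_x => y /= ->; rewrite !fctE.
  by case: (polyfun F y) => a b /=; rewrite mul0r subr0.
have -> : 'D_v (fun y => complex.Im ((f \o retr (sphere R n)) y)) x = 0.
  rewrite -(derive_vanishing_mul ch (G := fun y => complex.Im (polyfun F y)) _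
    dIm) ?Fx0 //.
  apply: near_eq_derive; apply: filterS near_x => y /= ->; rewrite !fctE.
  by case: (polyfun F y) => a b /=; rewrite mul0r addr0.
by [].
Qed.

End Sphere.

(** * Regular zero sets of eigenfunctions of low degree *)

Section Assembly.
Context {R : realType} {n : nat}.
Implicit Types (x v : 'rV[R]_n) (F : mpoly.mpoly n R[i]).

Lemma pgrad_real F x k :
  pgrad F (map_mx (real_complex R) x) 0 k = polyfun (mpoly.mderiv k F) x.
Proof. by rewrite mxE; apply: mpoly.meval_eq => i; rewrite mxE. Qed.

Lemma kappa_euclidean F x :
  kappa (euclidean R n) (polyfun F) (polyfun F) x =
  bdot (pgrad F (map_mx (real_complex R) x)) (pgrad F (map_mx (real_complex R) x)).
Proof.
have E : grad (euclidean R n) (polyfun F) x = pgrad F (map_mx (real_complex R) x).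
  rewrite /grad /ctproj /= map_mx1 mulmx1; apply/rowP => j.
  rewrite pgrad_real mxE -[LHS]/(cderive (polyfun F) _ _) cderive_polyfun.
  rewrite /dpolyfun (bigD1 j) //= big1 => [|i ij].
    by rewrite mxE !eqxx mul1r addr0.
  by rewrite mxE (negbTE ij) mul0r.
by rewrite /kappa E.
Qed.

Lemma pgrad_null F :
  (forall x, kappa (euclidean R n) (polyfun F) (polyfun F) x = 0) ->
  forall z, bdot (pgrad F z) (pgrad F z) = 0.
Proof.
move=> h z; pose Q := \sum_k mpoly.mderiv k F * mpoly.mderiv k F.
have QE w : bdot (pgrad F w) (pgrad F w) = mpoly.meval (w 0) Q.
  rewrite /Q (raddf_sum (mpoly.meval (w 0))); apply: eq_bigr => k _ /=.
  by rewrite mpoly.mevalM !mxE.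
rewrite QE; apply: meval_real_eq0 => x.
rewrite -[RHS](h x) kappa_euclidean QE.
by apply: mpoly.meval_eq => i; rewrite mxE.
Qed.

(** By homogeneity a critical point of F can be moved to the sphere, and by
    Euler's identity it is a zero of F. *)
Lemma regular_no_critical d F (f : 'rV[R]_n -> R[i]) x :
  F \is @mpoly.ishomog1 n R[i] d.+1 mpoly.mdeg ->
  (forall y, carrier (sphere R n) y -> f y = polyfun F y) ->
  regular_value (sphere R n) f 0 ->
  x != 0 -> pgrad F (map_mx (real_complex R) x) <> 0.
Proof.
move=> hF fF reg x_neq0 gradFx0.
pose a := (enorm x)^-1; pose u := a *: x.
have u1 : enorm u = 1 by exact: enorm_unit.
have u_neq0 : u != 0 by rewrite -enorm_gt0 u1 ltr01.
have gradFu0 : pgrad F (map_mx (real_complex R) u) = 0.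
  apply/rowP => k; rewrite pgrad_real (polyfun_scale _ _ (mderiv_homog k hF)).
  by rewrite -pgrad_real gradFx0 !mxE; exact: mulr0.
have Fu0 : polyfun F u = 0.
  apply: (@mulfI _ d.+1%:R); first by rewrite pnatr_eq0.
  rewrite mulr0 -(euler_homog _ hF) big1 // => k _.
  by rewrite -/(polyfun _ u) -pgrad_real gradFu0 [X in _ * X]mxE mulr0.
have fu0 : f u = 0 by rewrite fF.
have [v [_]] := reg u u1 fu0 1.
rewrite (tderive_critical v hF fF u_neq0 Fu0 gradFu0) => /eqP.
by rewrite eq_sym oner_eq0.
Qed.

(** F is the complex linear form with coefficients c; its real zeros are the
    common kernel of the real and imaginary parts of c. *)
Lemma linear_flat_section F (f : 'rV[R]_n -> R[i]) :
  F \is @mpoly.ishomog1 n R[i] 1 mpoly.mdeg ->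
  (forall y, carrier (sphere R n) y -> f y = polyfun F y) ->
  flat_section [set x | carrier (sphere R n) x /\ f x = 0].
Proof.
move=> hF fF.
pose c i : R[i] := mpoly.meval (fun=> 0) (mpoly.mderiv i F).
have FE x : polyfun F x = \sum_i (x 0 i)%:C * c i.
  rewrite -[LHS]mul1r -(euler_homog _ hF); apply: eq_bigr => i _.
  by congr (_ * _); exact: homog0_meval (mderiv_homog i hF).
pose A : 'M[R]_(n, 1) := \col_i complex.Re (c i).
pose B : 'M[R]_(n, 1) := \col_i complex.Im (c i).
have FAB x : polyfun F x = (x *m A) 0 0 +i* (x *m B) 0 0.
  rewrite FE !mxE; elim/big_rec3: _ => // i b a z _ ->.
  by rewrite !mxE; case: (c i) => ? ?; simpc.
exists (lker (linfun (mulmxr (row_mx A B)))).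
apply/seteqP; split => x /= [x1 hx]; split => //.
  rewrite memv_ker lfunE /= mul_mx_row.
  move: hx; rewrite fF // FAB => -[hA hB].
  by rewrite row_mx_eq0; apply/andP; split; apply/eqP/matrixP => i j;
     rewrite !ord1 ?hA ?hB mxE.
rewrite fF // FAB.
move: hx; rewrite memv_ker lfunE /= mul_mx_row row_mx_eq0.
by move=> /andP[/eqP -> /eqP ->]; rewrite !mxE.
Qed.

End Assembly.

Theorem proposition3p3 (R : realType) (f : 'rV[R]_5 -> R[i]) (lambda mu : R[i])
    (F : mpoly.mpoly 5 R[i])
    (f_eigen : eigenfunction (sphere R 5) lambda mu f)
    (f_poly : given_by_polynomial f F)
    (F_deg : (degree F <= 3)%N)
    (zero_in_image : exists2 x, carrier (sphere R 5) x & f x = 0)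
    (zero_regular : regular_value (sphere R 5) f 0) :
  flat_section [set x | carrier (sphere R 5) x /\ f x = 0].
Proof.
have [[d0 hF0] [_ _ kappaF] fF] := f_poly.
have gradF : forall z, bdot (pgrad F z) (pgrad F z) = 0.
  by apply: pgrad_null => x; rewrite kappaF // mul0r.
have hF : F \is @mpoly.ishomog1 5 R[i] (degree F) mpoly.mdeg.
  exact: mpoly.dhomog_msize hF0.
case dF : (degree F) F_deg hF => [|[|[|[|//]]]] _ hF.
- exfalso; have [x x1 fx0] := zero_in_image.
  have FC : F = mpoly.mpolyC 5 (mpoly.mcoeff mpoly.mnm0 F).
    by apply: mpoly.msize1_polyC; move: dF; rewrite /degree;
      case: (mpoly.msize F) => [|[]].
  have x_neq0 : x != 0 by rewrite -enorm_gt0 (x1 : enorm x = 1) ltr01.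
  have gradFx0 : pgrad F (map_mx (real_complex R) x) = 0.
    by apply/rowP => k; rewrite !mxE FC mpoly.mderivC mpoly.meval0.
  have Fx0 : polyfun F x = 0 by rewrite -fF.
  have [v [_]] := zero_regular x x1 fx0 1.
  rewrite (tderive_critical v hF fF x_neq0 Fx0 gradFx0) => /eqP.
  by rewrite eq_sym oner_eq0.
- exact: linear_flat_section hF fF.
- exfalso; have [x x_neq0] := critical_point_quadratic gradF hF.
  exact: regular_no_critical hF fF zero_regular x_neq0.
- exfalso; have [x x_neq0] := critical_point_cubic gradF hF.
  exact: regular_no_critical hF fF zero_regular x_neq0.
Qed.
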